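(* For $n \geq 1$ let $\sigma_n = \sqrt[n+1]{(n+1)!} - \sqrt[n]{n!}$. Then: (a) $\lim_{n \to \infty} \sigma_n = \frac{1}{e}$. (b) $0.42 > \sigma_1 > \sigma_2 > \sigma_3 > \cdots > \frac{1}{e}$. *)

(* Defs.v *)
From Stdlib Require Export Factorial Reals.
From Coquelicot Require Export Coquelicot.
Open Scope R_scope.

(* [Rpower x y = exp (y * ln x)], so this is the real n-th root of x when
   x > 0 and n >= 1. *)
Definition nroot (n : nat) (x : R) : R := Rpower x (/ INR n).

(* Meaningful for n >= 1 only; the value at n = 0 is junk. The trailing
   underscore avoids Stdlib's [sigma]. *)
Definition sigma_ (n : nat) : R :=
  nroot (n + 1) (INR (fact (n + 1))) - nroot n (INR (fact n)).

(* Main.v *)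
Require Import Defs.
From Stdlib Require Import Reals Lra Lia.
From Coquelicot Require Import Coquelicot.
Open Scope R_scope.

(* Write [a_n] for the [n]-th root of [n!] and [P_n] for the sum of the
   deficits [1 - k ln (1 + 1 / k)] over [k <= n]. Telescoping gives
   [a_n = (n + 1) exp (P_n / n - 1)] and, for [x_n = ln (a_(n+1) / a_n)],
   [x_n = (1 - P_n / n) / (n + 1)]. The deficits are about [1 / (2 k)], so
   [P_n] grows like [ln n / 2].
   Since [sigma_n = a_n (exp x_n - 1)], the limit follows from [P_n / n -> 0],
   and dividing [a_(n+1)] by [sigma_(n+1) < sigma_n] turns monotonicity into
   [1 + 1 / (exp x_n - 1) < 1 / (exp x_(n+1) - 1)]. Up to the third term
   [1 / (exp t - 1)] is [1 / t - 1 / 2 + t / 12], whereas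
   [1 / x_(n+1) - 1 / x_n] exceeds [1] by about [1 / (2 n)], which is more than
   [x_n / 12]. A strictly decreasing sequence stays above its limit. *)

Lemma le_of_is_derive_le (f g df dg : R -> R) (a b : R) :
  a <= b -> f a <= g a ->
  (forall x, a <= x <= b -> is_derive f x (df x)) ->
  (forall x, a <= x <= b -> is_derive g x (dg x)) ->
  (forall x, a <= x <= b -> df x <= dg x) ->
  f b <= g b.
Proof.
intros Hab Ha Hf Hg Hle.
assert (Hd : forall x, a <= x <= b ->
  is_derive (fun t => g t - f t) x (dg x - df x)).
{ intros x Hx. exact (is_derive_minus g f x _ _ (Hg x Hx) (Hf x Hx)). }
destruct (MVT_gen (fun t => g t - f t) a b (fun x => dg x - df x))
  as [c [Hc Heq]]; rewrite ?Rmin_left, ?Rmax_right in * by lra.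
- intros x Hx. apply Hd. lra.
- intros x Hx. apply continuity_pt_filterlim.
  apply (ex_derive_continuous (V := R_NormedModule) (fun t => g t - f t)).
  exists (dg x - df x). now apply Hd.
- pose proof (Hle c Hc). nra.
Qed.

Lemma ln_1_plus_ge_pade (x : R) : 0 <= x -> 2 * x / (2 + x) <= ln (1 + x).
Proof.
intros Hx.
apply (le_of_is_derive_le (fun t => 2 * t / (2 + t)) (fun t => ln (1 + t))
  (fun t => 4 / (2 + t) ^ 2) (fun t => / (1 + t)) 0).
- easy.
- rewrite !Rplus_0_r, ln_1. lra.
- intros t Ht. auto_derive; [lra | field; lra].
- intros t Ht. auto_derive; [lra | field; lra].
- intros t Ht. apply Rminus_le_0.
  replace (/ (1 + t) - 4 / (2 + t) ^ 2) with (t ^ 2 / ((1 + t) * (2 + t) ^ 2))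
    by (field; lra).
  apply Rdiv_le_0_compat; nra.
Qed.

Lemma ln_1_plus_le_pade (x : R) :
  0 <= x -> ln (1 + x) <= x * (6 + x) / (6 + 4 * x).
Proof.
intros Hx.
apply (le_of_is_derive_le (fun t => ln (1 + t))
  (fun t => t * (6 + t) / (6 + 4 * t))
  (fun t => / (1 + t)) (fun t => (9 + 3 * t + t ^ 2) / (3 + 2 * t) ^ 2) 0).
- easy.
- rewrite !Rplus_0_r, ln_1. lra.
- intros t Ht. auto_derive; [lra | field; lra].
- intros t Ht. auto_derive; [lra | field; lra].
- intros t Ht. apply Rminus_le_0.
  replace ((9 + 3 * t + t ^ 2) / (3 + 2 * t) ^ 2 - / (1 + t))
    with (t ^ 3 / ((1 + t) * (3 + 2 * t) ^ 2)) by (field; lra).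
  apply Rdiv_le_0_compat; [apply pow_le; lra | nra].
Qed.

Lemma exp_ge_pade (t : R) :
  0 <= t -> (12 + 6 * t + t ^ 2) / (12 - 6 * t + t ^ 2) <= exp t.
Proof.
intros Ht.
assert (Hnum : 0 < 12 + 6 * t + t ^ 2) by nra.
assert (Hden : forall s, 0 < 12 - 6 * s + s ^ 2)
  by (intros s; pose proof (pow2_ge_0 (s - 3)); lra).
apply Rnot_lt_le. intros Hlt.
apply ln_increasing in Hlt; [|apply exp_pos].
rewrite ln_exp, ln_div in Hlt by easy. revert Hlt. apply Rle_not_lt.
apply (le_of_is_derive_le
  (fun s => ln (12 + 6 * s + s ^ 2) - ln (12 - 6 * s + s ^ 2)) (fun s => s)
  (fun s => (6 + 2 * s) / (12 + 6 * s + s ^ 2)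
            - (2 * s - 6) / (12 - 6 * s + s ^ 2))
  (fun _ => 1) 0).
- easy.
- right. replace (12 + 6 * 0 + 0 ^ 2) with (12 - 6 * 0 + 0 ^ 2) by ring. ring.
- intros s Hs. pose proof (Hden s).
  auto_derive; [split; [nra | lra] | field; split; nra].
- intros s Hs. now auto_derive.
- intros s Hs. pose proof (Hden s). apply Rminus_le_0.
  replace (1 - _) with (s ^ 4 / ((12 + 6 * s + s ^ 2) * (12 - 6 * s + s ^ 2)))
    by (field; split; nra).
  apply Rdiv_le_0_compat; [apply pow_le; lra | nra].
Qed.

Lemma inv_expm1_ge (t : R) : 0 < t -> / t - 1 / 2 <= / (exp t - 1).
Proof.
intros Ht. pose proof (exp_ineq1 t) as He.
set (x := exp t - 1). assert (Hx : 0 < x) by (unfold x; lra).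
assert (Hln : 2 * x / (2 + x) <= t).
{ rewrite <- (ln_exp t). replace (exp t) with (1 + x) by (unfold x; ring).
  apply ln_1_plus_ge_pade. lra. }
apply Rinv_le_contravar in Hln; [|apply Rdiv_lt_0_compat; lra].
replace (/ (2 * x / (2 + x))) with (/ x + 1 / 2) in Hln by (field; lra).
lra.
Qed.

Lemma inv_expm1_le (t : R) : 0 < t -> / (exp t - 1) <= / t - 1 / 2 + t / 12.
Proof.
intros Ht.
assert (Hden : 0 < 12 - 6 * t + t ^ 2) by (pose proof (pow2_ge_0 (t - 3)); lra).
replace (/ t - 1 / 2 + t / 12) with (/ (12 * t / (12 - 6 * t + t ^ 2)))
  by (field; lra).
apply Rinv_le_contravar; [apply Rdiv_lt_0_compat; lra|].
replace (12 * t / (12 - 6 * t + t ^ 2))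
  with ((12 + 6 * t + t ^ 2) / (12 - 6 * t + t ^ 2) - 1) by (field; lra).
pose proof (exp_ge_pade t). lra.
Qed.

Lemma exp_mul_expm1_lt (x y : R) :
  0 < x -> 0 < y -> / x + 1 + x / 12 < / y ->
  exp x * (exp y - 1) < exp x - 1.
Proof.
intros Hx Hy Hxy.
pose proof (inv_expm1_le x Hx). pose proof (inv_expm1_ge y Hy).
assert (0 < exp x - 1) by (pose proof (exp_ineq1 x); lra).
assert (0 < exp y - 1) by (pose proof (exp_ineq1 y); lra).
assert (Hinv : 1 + / (exp x - 1) < / (exp y - 1)) by lra.
replace (1 + / (exp x - 1)) with (exp x / (exp x - 1)) in Hinv by (field; lra).
rewrite <- Rdiv_1_l, <- Rlt_div_r in Hinv by easy.
apply (Rmult_lt_reg_r (/ (exp x - 1))); [now apply Rinv_0_lt_compat|].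
rewrite Rinv_r by lra. unfold Rdiv in Hinv. lra.
Qed.

Definition log_deficit (x : R) : R := 1 - x * ln (1 + / x).

Lemma log_deficit_bounds (x : R) :
  0 < x -> 3 / (6 * x + 4) <= log_deficit x <= 1 / (2 * x + 1).
Proof.
intros Hx. assert (Hi : 0 <= / x) by (left; now apply Rinv_0_lt_compat).
pose proof (Rmult_le_compat_l x _ _ (Rlt_le _ _ Hx) (ln_1_plus_ge_pade _ Hi))
  as Hge.
pose proof (Rmult_le_compat_l x _ _ (Rlt_le _ _ Hx) (ln_1_plus_le_pade _ Hi))
  as Hle.
replace (x * (2 * / x / (2 + / x))) with (1 - 1 / (2 * x + 1)) in Hge
  by (field; lra).
replace (x * (/ x * (6 + / x) / (6 + 4 * / x))) with (1 - 3 / (6 * x + 4)) in Hle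
  by (field; lra).
unfold log_deficit. lra.
Qed.

Lemma log_deficit_ge_0 (x : R) : 0 < x -> 0 <= log_deficit x.
Proof.
intros Hx. apply Rle_trans with (3 / (6 * x + 4)); [|now apply log_deficit_bounds].
apply Rdiv_le_0_compat; lra.
Qed.

(* The sum of [log_deficit k] over [1 <= k <= n], in closed form. *)
Definition sum_log_deficit (n : nat) : R :=
  INR n * (1 - ln (INR n + 1)) + ln (INR (fact n)).

Lemma sum_log_deficit_S (n : nat) :
  sum_log_deficit (S n) = sum_log_deficit n + log_deficit (INR n + 1).
Proof.
unfold sum_log_deficit, log_deficit. pose proof (pos_INR n).
rewrite fact_simpl, mult_INR, S_INR.
rewrite ln_mult by (apply INR_fact_lt_0 || lra).
replace (1 + / (INR n + 1)) with ((INR n + 1 + 1) / (INR n + 1)) by (field; lra).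
rewrite ln_div by lra. ring.
Qed.

Lemma sum_log_deficit_ge_0 (n : nat) : 0 <= sum_log_deficit n.
Proof.
induction n as [|n IH].
- unfold sum_log_deficit. simpl. rewrite ln_1. lra.
- rewrite sum_log_deficit_S. pose proof (pos_INR n).
  pose proof (log_deficit_ge_0 (INR n + 1)). lra.
Qed.

Lemma ln_2_ge : 24 / 35 <= ln 2.
Proof.
replace 2 with ((1 + 1 / 2) * (1 + 1 / 3)) by field.
rewrite ln_mult by lra.
pose proof (ln_1_plus_ge_pade (1 / 2)). pose proof (ln_1_plus_ge_pade (1 / 3)).
lra.
Qed.

(* Much weaker than the actual logarithmic growth, but it is inductive and
   sharp enough at [n = 1]. *)
Lemma sum_log_deficit_le (n : nat) :
  (1 <= n)%nat -> (sum_log_deficit n + 3 / 5) ^ 2 <= 5 / 12 * INR n + 21 / 50.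
Proof.
induction 1 as [|n Hn IH].
- pose proof (sum_log_deficit_ge_0 1) as HP.
  assert (Hone : sum_log_deficit 1 = 1 - ln 2)
    by (unfold sum_log_deficit; simpl; rewrite ln_1; change (1 + 1) with 2; ring).
  rewrite Hone in *. pose proof ln_2_ge. simpl INR. nra.
- rewrite sum_log_deficit_S, S_INR. apply (le_INR 1) in Hn. simpl in Hn.
  pose proof (sum_log_deficit_ge_0 n) as HP.
  destruct (log_deficit_bounds (INR n + 1)) as [_ Hle]; [lra|].
  pose proof (log_deficit_ge_0 (INR n + 1)) as Hq0.
  set (x := INR n) in *. set (P := sum_log_deficit n) in *.
  set (q := log_deficit (x + 1)) in *.
  assert (Hq : q * (2 * x + 3) <= 1).
  { rewrite Rle_div_r by lra. replace (2 * x + 3) with (2 * (x + 1) + 1) by ring.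
    easy. }
  assert (P <= 5 / 12 * x - 3 / 40) by nra.
  assert (q <= 1 / 5) by nra.
  assert (q * (2 * P + q + 6 / 5) <= 5 / 12) by nra.
  nra.
Qed.

Lemma sum_log_deficit_lt (n : nat) : (1 <= n)%nat -> sum_log_deficit n < INR n.
Proof.
intros Hn. pose proof (sum_log_deficit_le n Hn). apply (le_INR 1) in Hn.
simpl in Hn. nra.
Qed.

Lemma is_lim_seq_sum_log_deficit_div :
  is_lim_seq (fun n => sum_log_deficit n / INR n) 0.
Proof.
apply is_lim_seq_le_le_loc with (fun _ => 0) (fun n => / sqrt (INR n)).
- exists 1%nat. intros n Hn.
  pose proof (sum_log_deficit_ge_0 n) as HP.
  pose proof (sum_log_deficit_le n Hn) as Hle.
  apply (le_INR 1) in Hn. simpl in Hn.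
  split; [apply Rdiv_le_0_compat; lra|].
  assert (Hsqrt : sum_log_deficit n <= sqrt (INR n)).
  { rewrite <- (sqrt_pow2 (sum_log_deficit n)) by easy.
    apply sqrt_le_1_alt. nra. }
  apply Rle_div_l; [lra|].
  rewrite <- (sqrt_def (INR n)) at 2 by lra.
  assert (sqrt (INR n) <> 0) by (apply Rgt_not_eq, sqrt_lt_R0; lra).
  now rewrite <- Rmult_assoc, Rinv_l, Rmult_1_l.
- apply is_lim_seq_const.
- apply (is_lim_seq_inv _ p_infty); [|easy].
  apply (is_lim_comp_seq sqrt INR p_infty).
  + apply (is_lim_sqrt_p (fun x => x)), is_lim_id.
  + now exists 0%nat.
  + apply is_lim_seq_INR.
Qed.

Definition root_fact (n : nat) : R := nroot n (INR (fact n)).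

Lemma root_fact_eq (n : nat) :
  (1 <= n)%nat ->
  root_fact n = (INR n + 1) * exp (sum_log_deficit n / INR n - 1).
Proof.
intros Hn. apply (le_INR 1) in Hn. simpl in Hn.
rewrite <- (exp_ln (INR n + 1)) at 1 by lra. rewrite <- exp_plus.
unfold root_fact, nroot, Rpower, sum_log_deficit. f_equal. field. lra.
Qed.

Lemma is_lim_seq_root_fact_div :
  is_lim_seq (fun n => root_fact n / (INR n + 1)) (exp (- 1)).
Proof.
apply is_lim_seq_ext_loc with (fun n => exp (sum_log_deficit n / INR n - 1)).
- exists 1%nat. intros n Hn. rewrite root_fact_eq by easy.
  field. pose proof (pos_INR n). lra.
- apply (is_lim_seq_continuous exp).
  { apply derivable_continuous_pt, derivable_pt_exp. }
  replace (Finite (- 1)) with (Finite (0 - 1)) by (f_equal; ring).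
  apply is_lim_seq_minus'; [|apply is_lim_seq_const].
  apply is_lim_seq_sum_log_deficit_div.
Qed.

Definition log_ratio (n : nat) : R := ln (root_fact (S n) / root_fact n).

Lemma root_fact_pos (n : nat) : 0 < root_fact n.
Proof. apply exp_pos. Qed.

Lemma root_fact_S (n : nat) : root_fact (S n) = root_fact n * exp (log_ratio n).
Proof.
pose proof (root_fact_pos n). pose proof (root_fact_pos (S n)).
unfold log_ratio. rewrite exp_ln by now apply Rdiv_lt_0_compat.
field. lra.
Qed.

Lemma log_ratio_eq (n : nat) :
  (1 <= n)%nat ->
  log_ratio n = (INR n - sum_log_deficit n) / (INR n * (INR n + 1)).
Proof.
intros Hn. unfold log_ratio.
rewrite ln_div by apply root_fact_pos.
unfold root_fact, nroot, Rpower, sum_log_deficit. rewrite !ln_exp.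
rewrite fact_simpl, mult_INR. apply (le_INR 1) in Hn. simpl INR in Hn.
rewrite ln_mult, S_INR by (apply INR_fact_lt_0 || (rewrite S_INR; lra)).
field. lra.
Qed.

Lemma log_ratio_pos (n : nat) : (1 <= n)%nat -> 0 < log_ratio n.
Proof.
intros Hn. rewrite log_ratio_eq by easy.
pose proof (sum_log_deficit_lt n Hn). apply (le_INR 1) in Hn. simpl in Hn.
apply Rdiv_lt_0_compat; nra.
Qed.

Lemma log_ratio_le (n : nat) : (1 <= n)%nat -> log_ratio n <= / (INR n + 1).
Proof.
intros Hn. rewrite log_ratio_eq by easy.
pose proof (sum_log_deficit_ge_0 n). apply (le_INR 1) in Hn. simpl in Hn.
apply Rle_div_l; [nra|].
replace (/ (INR n + 1) * (INR n * (INR n + 1))) with (INR n) by (field; lra).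
lra.
Qed.

(* What [inv_log_ratio_S] reduces to once denominators are cleared. *)
Lemma sum_log_deficit_gap (n : nat) :
  (1 <= n)%nat ->
  sum_log_deficit n * (sum_log_deficit n + 1 + log_deficit (INR n + 1))
    + INR n / 12 < INR n * (INR n + 2) * log_deficit (INR n + 1).
Proof.
intros Hn.
pose proof (sum_log_deficit_ge_0 n) as HP0.
pose proof (sum_log_deficit_le n Hn) as HP.
apply (le_INR 1) in Hn. simpl in Hn.
destruct (log_deficit_bounds (INR n + 1)) as [Hge Hle]; [lra|].
set (x := INR n) in *. set (P := sum_log_deficit n) in *.
set (q := log_deficit (x + 1)) in *.
assert (Hq : q <= 1 / 5).
{ apply (Rle_trans _ _ _ Hle), Rmult_le_compat_l; [lra|].
  apply Rinv_le_contravar; lra. }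
assert (Hmain : x / 2 + 1 / 16 <= x * (x + 2) * q).
{ apply Rle_trans with (x * (x + 2) * (3 / (6 * (x + 1) + 4))).
  - rewrite Rmult_div_assoc. apply Rle_div_r; nra.
  - apply Rmult_le_compat_l; nra. }
nra.
Qed.

Lemma inv_log_ratio_S (n : nat) :
  (1 <= n)%nat -> / log_ratio n + 1 + log_ratio n / 12 < / log_ratio (S n).
Proof.
intros Hn.
pose proof (log_ratio_le n Hn) as Hle.
pose proof (sum_log_deficit_ge_0 n) as HP0.
pose proof (sum_log_deficit_lt n Hn) as HP.
pose proof (sum_log_deficit_ge_0 (S n)) as HPS0.
pose proof (sum_log_deficit_lt (S n) (le_S _ _ Hn)) as HPS.
pose proof (sum_log_deficit_gap n Hn) as Hgap.
apply Rle_lt_trans with (/ log_ratio n + 1 + / (INR n + 1) / 12); [lra|].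
rewrite (log_ratio_eq n), (log_ratio_eq (S n)) by lia.
rewrite sum_log_deficit_S, S_INR in *. apply (le_INR 1) in Hn. simpl in Hn.
set (x := INR n) in *. set (P := sum_log_deficit n) in *.
set (q := log_deficit (x + 1)) in *.
set (c := x - P). set (c' := x + 1 - (P + q)).
assert (Hc : 0 < c <= x) by (unfold c; lra).
assert (Hc' : 0 < c' <= x + 1) by (unfold c'; lra).
assert (Hcc' : c * c' / (x + 1) <= x) by (apply Rle_div_l; nra).
apply (Rmult_lt_reg_l (c * c')); [nra|].
rewrite Rmult_plus_distr_l.
replace (c * c' * (/ (c / (x * (x + 1))) + 1)) with (x * (x + 1) * c' + c * c')
  by (field; lra).
replace (c * c' * / (c' / ((x + 1) * (x + 1 + 1)))) with ((x + 1) * (x + 2) * c)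
  by (field; lra).
unfold c, c' in *. lra.
Qed.

Lemma sigma_eq (n : nat) : sigma_ n = root_fact n * (exp (log_ratio n) - 1).
Proof.
unfold sigma_. rewrite Nat.add_1_r. fold (root_fact n) (root_fact (S n)).
rewrite root_fact_S. ring.
Qed.

Lemma sigma_S_lt (n : nat) : (1 <= n)%nat -> sigma_ (S n) < sigma_ n.
Proof.
intros Hn. rewrite !sigma_eq, root_fact_S, Rmult_assoc.
apply Rmult_lt_compat_l; [apply root_fact_pos|].
apply exp_mul_expm1_lt.
- now apply log_ratio_pos.
- apply log_ratio_pos. lia.
- now apply inv_log_ratio_S.
Qed.

Lemma is_lim_seq_INR_mul_log_ratio :
  is_lim_seq (fun n => (INR n + 1) * log_ratio n) 1.
Proof.
apply is_lim_seq_ext_loc with (fun n => 1 - sum_log_deficit n / INR n).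
- exists 1%nat. intros n Hn. rewrite log_ratio_eq by easy.
  apply (le_INR 1) in Hn. simpl in Hn. field. lra.
- replace (Finite 1) with (Finite (1 - 0)) by (f_equal; ring).
  apply is_lim_seq_minus'; [apply is_lim_seq_const|].
  apply is_lim_seq_sum_log_deficit_div.
Qed.

Lemma is_lim_seq_log_ratio : is_lim_seq log_ratio 0.
Proof.
apply is_lim_seq_ext with (fun n => (INR n + 1) * log_ratio n * / INR (S n)).
- intros n. rewrite S_INR. field. pose proof (pos_INR n). lra.
- replace (Finite 0) with (Finite (1 * 0)) by (f_equal; ring).
  apply is_lim_seq_mult'; [apply is_lim_seq_INR_mul_log_ratio|].
  apply (is_lim_seq_inv _ p_infty); [|easy].
  apply (is_lim_seq_incr_1 INR), is_lim_seq_INR.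
Qed.

Lemma is_lim_seq_sigma : is_lim_seq sigma_ (exp (- 1)).
Proof.
apply is_lim_seq_ext_loc with (fun n =>
  root_fact n / (INR n + 1) * ((INR n + 1) * log_ratio n) *
  ((exp (log_ratio n) - 1) / log_ratio n)).
- exists 1%nat. intros n Hn. rewrite sigma_eq.
  pose proof (log_ratio_pos n Hn). pose proof (pos_INR n). field. lra.
- replace (Finite (exp (- 1))) with (Finite (exp (- 1) * 1 * 1))
    by (f_equal; ring).
  apply is_lim_seq_mult'; [apply is_lim_seq_mult'|].
  + apply is_lim_seq_root_fact_div.
  + apply is_lim_seq_INR_mul_log_ratio.
  + apply (is_lim_comp_seq (fun t => (exp t - 1) / t) log_ratio 0).
    * apply is_lim_div_expm1_0.
    * exists 1%nat. intros n Hn [= E]. pose proof (log_ratio_pos n Hn). lra.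
    * apply is_lim_seq_log_ratio.
Qed.

Lemma lim_lt_sigma (n : nat) : (1 <= n)%nat -> exp (- 1) < sigma_ n.
Proof.
intros Hn. apply Rle_lt_trans with (sigma_ (S n)); [|now apply sigma_S_lt].
apply (is_lim_seq_decr_compare (fun k => sigma_ (S k))).
- apply (is_lim_seq_incr_1 sigma_), is_lim_seq_sigma.
- intros k. left. apply sigma_S_lt. lia.
Qed.

Lemma sigma_1_lt : sigma_ 1 < 0.42.
Proof.
unfold sigma_, nroot. simpl.
replace (/ (1 + 1)) with (/ 2) by lra.
rewrite Rinv_1, Rpower_1, Rpower_sqrt by lra.
assert (sqrt (1 + 1) < 1.42); [|lra].
rewrite <- (sqrt_pow2 1.42) by lra. apply sqrt_lt_1; lra.
Qed.

Theorem theorem6p1 :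
  is_lim_seq sigma_ (Finite (1 / exp 1)) /\
  (sigma_ 1 < 0.42 /\
   (forall n : nat, (1 <= n)%nat -> sigma_ (n + 1) < sigma_ n) /\
   (forall n : nat, (1 <= n)%nat -> 1 / exp 1 < sigma_ n)).
Proof.
rewrite Rdiv_1_l, <- exp_Ropp.
split; [exact is_lim_seq_sigma|].
split; [exact sigma_1_lt|].
split; [|exact lim_lt_sigma].
intros n Hn. rewrite Nat.add_1_r. now apply sigma_S_lt.
Qed.
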